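(* Let $(\mathcal{A},+)$ be a finite Abelian group, let $\mathfrak{G}\subseteq\mathcal{A}^{\mathbb{Z}}$ be a Markov subgroup with $0$–$1$ incidence matrix $\mathbf{M}$, and let $\mu$ be a Markov probability measure on $\mathcal{A}^{\mathbb{Z}}$ compatible with $\mathbf{M}$. Assume that $\mathcal{A}$ is $p^s$-torsion for some prime number $p$ and some integer $s\ge 1$, and that $\mathbf{M}$ is irreducible. Let $\Phi=\mathrm{id}+\sigma$ on $\mathcal{A}^{\mathbb{Z}}$. Then the Cesàro mean of $\mu$ under the action of $\Phi$ converges to the Haar measure $\nu$ of $\mathfrak{G}$; that is, for every integer $m\ge 1$ and every $\mathbf{g}\in\mathfrak{G}_m$, $$\lim_{N\to\infty}\frac1N\sum_{n=0}^{N-1}\mu\Big(\{\mathbf{x}\in\mathcal{A}^{\mathbb{Z}} : (\Phi^n\mathbf{x})_0^{m-1}=\mathbf{g}\}\Big)=\nu\Big(\{\mathbf{x}: \mathbf{x}_0^{m-1}=\mathbf{g}\}\Big).$$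
   Context: $\mathcal{A}^{\mathbb{Z}}$ is the product group with componentwise addition, and $\sigma$ is the shift $(\sigma\mathbf{x})_n=x_{n+1}$. Thus $(\Phi\mathbf{x})_n=x_n+x_{n+1}$ for all $n\in\mathbb{Z}$. For integers $m\le n$, $\mathbf{x}_m^n=(x_m,x_{m+1},\dots,x_n)$. A Markov subgroup $\mathfrak{G}$ with incidence matrix $\mathbf{M}=(\mathbf{M}_{gh})_{g,h\in\mathcal{A}}$, $\mathbf{M}_{gh}\in\{0,1\}$, is the topological Markov shift $\mathfrak{G}=\{\mathbf{x}\in\mathcal{A}^{\mathbb{Z}}:\mathbf{M}_{x_ix_{i+1}}=1\ \forall i\in\mathbb{Z}\}$, assumed to be a subgroup of $\mathcal{A}^{\mathbb{Z}}$. For $g\in\mathcal{A}$, $\mathcal{F}(g)=\{h\in\mathcal{A}:\mathbf{M}_{gh}=1\}$ is the set of followers of $g$, and $\mathcal{F}=\mathcal{F}(0)$, which is a subgroup of $\mathcal{A}$; each $\mathcal{F}(g)$ is a coset of $\mathcal{F}$. $\mathbf{M}$ is irreducible if there is $n\ge1$ such that $\mathcal{F}^n(0):=\{h\in\mathcal{A}:(\mathbf{M}^n)_{0h}>0\}$ equals $\mathcal{A}$ (equivalently, the Markov shift $\mathfrak{G}$ is transitive). $\mathcal{A}$ is $p^s$-torsion if $p^s g=0$ for every $g\in\mathcal{A}$. A Markov probability measure $\mu$ on $\mathcal{A}^{\mathbb{Z}}$ is the (stationary) one defined by a stochastic matrix $\mathbf{P}=(\mathbf{P}_{gh})_{g,h\in\mathcal{A}}$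 and a probability vector $\pi$ with $\pi\mathbf{P}=\pi$. It is compatible with $\mathbf{M}$ if for all $g,h$: $\mathbf{P}_{gh}>0$ if and only if $\mathbf{M}_{gh}>0$. For $\ell\ge1$, $\mathfrak{G}_\ell=\{(g_0,\dots,g_{\ell-1})\in\mathcal{A}^\ell: g_{i+1}\in\mathcal{F}(g_i)\ \forall i\in\{0,\dots,\ell-2\}\}$. The Haar measure $\nu$ of $(\mathfrak{G},+)$ is the Markov measure with transition matrix $L_{gh}=|\mathcal{F}|^{-1}$ if $h\in\mathcal{F}(g)$, $L_{gh}=0$ otherwise, and stationary vector uniform on $\mathcal{A}$; so for $\mathbf{g}\in\mathfrak{G}_\ell$ the right-hand side value is $\nu(\mathbf{x}_0^{\ell-1}=\mathbf{g})=\gamma_\ell=\frac{1}{|\mathcal{A}|\,|\mathcal{F}|^{\ell-1}}$. *)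

(* Defs.v *)
From HB Require Import structures.
From mathcomp Require Import all_boot all_order all_algebra.
From mathcomp Require Import all_classical all_reals all_analysis.

Set Implicit Arguments.
Unset Strict Implicit.
Unset Printing Implicit Defensive.

Import Order.TTheory GRing.Theory Num.Theory.

Local Open Scope classical_set_scope.
Local Open Scope ring_scope.

Definition AZ (A : finZmodType) := int -> A.

HB.instance Definition _ (A : finZmodType) := GRing.Zmodule.on (AZ A).
HB.instance Definition _ (A : finZmodType) := isPointed.Build (AZ A) 0.

(* A being finite and discrete, the sigma-algebra generated by these sets is
   both the product and the Borel sigma-algebra of A^Z. *)
Definition coord_cylinders (A : finZmodType) : set (set (AZ A)) :=
  [set B | exists (i : int) (a : A), B = [set x : AZ A | x i = a]].
Arguments coord_cylinders A : clear implicits.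

HB.instance Definition _ (A : finZmodType) :=
  @isMeasurable.Build (sigma_display (coord_cylinders A)) (AZ A)
    <<s coord_cylinders A >> (@sigma_algebra0 _ setT (coord_cylinders A))
    (@sigma_algebraC _ (coord_cylinders A))
    (@sigma_algebra_bigcup _ setT (coord_cylinders A)).

Section FullShift.
Variable A : finZmodType.

Definition shift (x : AZ A) : AZ A := fun n => x (n + 1).

Definition Phi (x : AZ A) : AZ A := x + shift x.

(* (x_k, ..., x_(k+l-1)), indexed by its first position and its length. *)
Definition block (x : AZ A) (k : int) (l : nat) : l.-tuple A :=
  [tuple x (k + (i : nat)%:Z) | i < l].

End FullShift.

Section Incidence.
Variables (A : finZmodType) (M : rel A).

Definition followers (g : A) : {set A} := [set h | M g h].

Definition markov_shift : set (AZ A) :=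
  [set x : AZ A | forall i : int, M (x i) (x (i + 1))].

Definition markov_subgroup : Prop := zmod_closed (mem markov_shift).

Definition incidence_mx : 'M[nat]_#|A| :=
  \matrix_(i, j) (M (enum_val i) (enum_val j) : nat).

Definition followers_iter (n : nat) (g : A) : {set A} :=
  [set h | (0 < (incidence_mx ^+ n) (enum_rank g) (enum_rank h))%N].

Definition irreducible_incidence : Prop :=
  exists2 n : nat, (1 <= n)%N & followers_iter n 0 = [set: A]%SET.

Definition admissible_words (l : nat) : {set l.-tuple A} :=
  [set g : l.-tuple A |
    [forall i : 'I_l, forall j : 'I_l,
      (j == i.+1 :> nat) ==> (tnth g j \in followers (tnth g i))]].

End Incidence.

Section MarkovMeasure.
Variables (R : realType) (A : finZmodType).

Definition stochastic (P : A -> A -> R) : Prop :=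
  (forall g h, 0 <= P g h) /\ (forall g, \sum_h P g h = 1).

Definition probability_vector (p : A -> R) : Prop :=
  (forall g, 0 <= p g) /\ \sum_g p g = 1.

Definition stationary (p : A -> R) (P : A -> A -> R) : Prop :=
  forall h, \sum_g p g * P g h = p h.

Definition compatible (P : A -> A -> R) (M : rel A) : Prop :=
  forall g h, 0 < P g h <-> M g h.

(* The cylinder formula determines mu, as cylinders form a generating
   pi-system. *)
Definition markov_measure (p : A -> R) (P : A -> A -> R)
    (mu : probability (AZ A) R) : Prop :=
  [/\ stochastic P, probability_vector p, stationary p P &
      forall (k : int) (l : nat) (g : l.+1.-tuple A),
        mu [set x : AZ A | block x k l.+1 = g] =
        (p (thead g) * \prod_(i < l) P (nth 0 g i) (nth 0 g i.+1))%:E].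

(* Haar probability measure of a closed subgroup G, viewed as a measure on A^Z
   concentrated on G. *)
Definition haar_measure (G : set (AZ A)) (nu : probability (AZ A) R) : Prop :=
  nu G = 1%E /\
  forall (y : AZ A) (B : set (AZ A)), G y -> measurable B ->
    nu [set y + x | x in B] = nu B.

End MarkovMeasure.

(* Main.v *)
Require Import Defs.
From HB Require Import structures.
From mathcomp Require Import all_boot all_order all_algebra.
From mathcomp Require Import all_classical all_reals all_analysis.
From mathcomp Require Import zify ring lra.

Set Implicit Arguments.
Unset Strict Implicit.
Unset Printing Implicit Defensive.

Import Order.TTheory GRing.Theory Num.Theory.
Import numFieldNormedType.Exports.

Local Open Scope classical_set_scope.
Local Open Scope ring_scope.

(** Why the Cesaro means converge.  Fix a window length [m].  The window of
    [Phi^n x] is a sum over the coordinates [k] of homomorphisms applied to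
    [x_k], with binomial coefficients as multipliers.  Under a Markov measure it
    is therefore the end point of a walk on [A^m] whose steps are driven by a
    Markov chain.  It is enough to show that this end point gives nearly the
    same probability to any two words [g] and [g'] of the subgroup: the Haar
    measure gives them equal probability, and both laws have total mass one on
    these words ([near_average]).

    Mixing.  Let [h = g - g'], and suppose that on [l] consecutive coordinates
    there is an admissible path from 0 to 0, a loop, whose contribution to the
    sum is [h].  Adding multiples of the loop to a path changes neither its last
    letter nor its admissibility and moves the sum by multiples of [h].  The
    increments [v (w + h) - v w] of a function [v] add up to zero along the
    finite cyclic group generated by [h], so one of these paths meets an
    increment that is at most 0.  Its probability is at least [eps ^ l], where
    [eps] bounds the positive transition probabilities from below; hence an
    upper bound on the increments is multiplied by [1 - eps ^ l]
    ([transfer_contract_upper]).  With [D] disjoint loops of the same length the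
    two probabilities differ by at most [(1 - eps ^ l) ^ D]
    ([transfer_mixing]).

    Loops.  The equation [Phi y = x] can be solved from left to right inside the
    subgroup, and irreducibility allows any two configurations of the subgroup
    to be glued across [r] coordinates.  So for every [n0] there is a finitely
    supported [y] in the subgroup with [Phi^n0 y = h] on the window, supported
    within [r] coordinates of the interval from [n0] to [n0 + m]
    ([markov_shift_local_preimage]).  Let the alphabet be [p ^ (s + 1)]-torsion.
    Modulo [p ^ (s + 1)],
    [(1 + X) ^ (p ^ k * p ^ s) = (1 + X ^ (p ^ k)) ^ (p ^ s)].  Hence, for
    [n = n0 + p ^ k * p ^ s * q], applying [Phi^n] amounts to applying [Phi^n0]
    and then summing the translates by [j * p ^ k] with weights
    ['C(p ^ s * q, j)].  If [p ^ k] is at least [n0 + m + r], the translate of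
    [y] by [j * p ^ k] meets the window in one term only and contributes
    ['C(p ^ s * q, j)] times [h].  When [p ^ D] divides [q + 1] these coefficients are prime to [p] for
    [j = i * p ^ s] with [i < p ^ D], and after rescaling [y] the contribution
    is exactly [h] ([has_loop_iter_Phi]).  This gives as many disjoint loops as
    desired, all of the same length.

    Density.  The condition on [n] holds as soon as some digit of [n] in a
    suitable base [b] has a prescribed value ([prob_window_close]).  The integers
    without such a digit have density zero, so they do not affect the Cesaro
    means ([cesaro_small_off_digit]). *)

(** * Binomial coefficients modulo powers of a prime *)

Definition congr_modn (S : comNzRingType) (N : nat) (f g : S) : Prop :=
  exists u, f = g + u *+ N.

Lemma congr_modn_mul (S : comNzRingType) N (f g f' g' : S) :
  congr_modn N f g -> congr_modn N f' g' -> congr_modn N (f * f') (g * g').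
Proof.
move=> [u ->] [u' ->]; exists (g * u' + u * g' + u * u' *+ N).
by ring.
Qed.

Lemma congr_modn_exp (S : comNzRingType) N (f g : S) n :
  congr_modn N f g -> congr_modn N (f ^+ n) (g ^+ n).
Proof.
move=> fg; elim: n => [|n IHn]; first by exists 0; rewrite mul0rn addr0.
by rewrite !exprS; apply: congr_modn_mul.
Qed.

Lemma congr_modn_trans (S : comNzRingType) N (f g h : S) :
  congr_modn N f g -> congr_modn N g h -> congr_modn N f h.
Proof. by move=> [u ->] [v ->]; exists (u + v); rewrite mulrnDl; ring. Qed.

Lemma congr_modn_sum (S : comNzRingType) N n (f g : 'I_n -> S) :
  (forall i, congr_modn N (f i) (g i)) ->
  congr_modn N (\sum_i f i) (\sum_i g i).
Proof.
move=> fg; elim/big_ind2: _ => //; first by exists 0; rewrite mul0rn addr0.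
move=> x1 x2 y1 y2 [u ->] [v ->]; exists (u + v); rewrite mulrnDl; ring.
Qed.

(** The [p]-th power gains one factor [p]: in the factorization of
    [f ^+ p - g ^+ p] by [f - g], the cofactor is a sum of [p] terms that are
    all congruent to [g ^+ p.-1] modulo [p]. *)
Lemma congr_modn_expp (S : comNzRingType) p a (f g : S) : (0 < p)%N ->
  congr_modn (p ^ a.+1) f g -> congr_modn (p ^ a.+2) (f ^+ p) (g ^+ p).
Proof.
move=> p_gt0 [u def_f].
have fg : congr_modn p f g.
  by exists (u *+ p ^ a); rewrite def_f expnSr mulrnA.
have [v Dv] : congr_modn p (\sum_(i < p) f ^+ (p.-1 - i) * g ^+ i)
                           (\sum_(i < p) g ^+ p.-1).
  apply: congr_modn_sum => i.
  have {2}-> : p.-1 = (p.-1 - i + i)%N by rewrite subnK //; have := ltn_ord i; lia.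
  rewrite exprD; apply: congr_modn_mul (congr_modn_exp _ fg) _.
  by exists 0; rewrite mul0rn addr0.
exists (u * (g ^+ p.-1 + v)); apply/eqP; rewrite addrC -subr_eq.
case: p p_gt0 def_f fg Dv => // p _ def_f fg Dv.
rewrite subrXX Dv sumr_const card_ord def_f [_ + _ - g]addrAC subrr add0r -mulrnDl.
by rewrite [(p.+1 ^ a.+2)%N]expnSr mulrnAl mulrnAr -mulrnA [(p.+1 * _)%N]mulnC. 
Qed.

Lemma congr_modn_exprD (S : comNzRingType) p (x y : S) :
  prime p -> congr_modn p ((x + y) ^+ p) (x ^+ p + y ^+ p).
Proof.
move=> p_pr; case: p p_pr => // p p_pr.
rewrite exprDn big_ord_recl big_ord_recr /= bin0 binn !mulr1n expr0 mulr1.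
rewrite subnn expr0 mul1r.
have [v ->] : congr_modn p.+1
    (\sum_(i < p) (x ^+ (p.+1 - bump 0 i) * y ^+ bump 0 i)
       *+ 'C(p.+1, bump 0 i)) (\sum_(i < p) 0).
  apply: congr_modn_sum => i.
  have /dvdnP[k ->] : (p.+1 %| 'C(p.+1, bump 0 i))%N.
    by apply: prime_dvd_bin; rewrite // /bump leq0n add1n /= ltnS ltn_ord.
  by exists (x ^+ (p.+1 - bump 0 i) * y ^+ bump 0 i *+ k); rewrite add0r mulrnA.
by exists v; rewrite sumr_const mul0rn add0r -addrA [_ + y ^+ _]addrC addrA.
Qed.

Lemma congr_modn_exprD1X p k L :
  prime p -> congr_modn p ((1 + 'X^L : {poly int}) ^+ (p ^ k)) (1 + 'X^(L * p ^ k)).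
Proof.
move=> p_pr; elim: k => [|k IHk].
  by rewrite expn0 muln1 expr1; exists 0; rewrite mul0rn addr0.
rewrite expnSr mulnA 2!exprM; apply: congr_modn_trans (congr_modn_exp p IHk) _.
by have := congr_modn_exprD (1 : {poly int}) 'X^(L * p ^ k) p_pr; rewrite expr1n -exprM.
Qed.

(** Lifting of the Frobenius identity from modulus [p] to modulus [p ^ a.+1]:
    it starts from [congr_modn_exprD1X], and each further [p]-th power improves
    the modulus by [congr_modn_expp]. *)
Lemma congr_modn_exp1X p k a :
  prime p ->
  congr_modn (p ^ a.+1) ((1 + 'X : {poly int}) ^+ (p ^ k * p ^ a))
                        ((1 + 'X^(p ^ k)) ^+ (p ^ a)).
Proof.
move=> p_pr; elim: a => [|a IHa].
  rewrite muln1 !expn1 expr1; have := congr_modn_exprD1X k 1 p_pr.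
  by rewrite mul1n.
rewrite (expnSr p a) mulnA !(exprM _ _ p).
by apply: congr_modn_expp; rewrite ?prime_gt0.
Qed.

Lemma coef_exp1Xn L n i : (0 < L)%N ->
  ((1 + 'X^L : {poly int}) ^+ n)`_(i * L) = 'C(n, i)%:R.
Proof.
move=> L_gt0; rewrite addrC exprDn_comm; last exact: commr1.
under eq_bigr do rewrite expr1n mulr1 -exprM.
rewrite coef_sum; have [lt_ni|le_in] := ltnP n i.
  rewrite bin_small // big1 // => j _; rewrite coefMn coefXn.
  rewrite [_ == _](_ : _ = false) ?mul0rn //; apply/negbTE.
  by have := ltn_ord j; rewrite mulnC eqn_pmul2l //; lia.
have lt_n : (n - i < n.+1)%N by lia.
rewrite (bigD1 (Ordinal lt_n)) //= big1 ?addr0 => [|j ne_j].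
  by rewrite coefMn coefXn subKn // mulnC eqxx bin_sub // natz.
rewrite coefMn coefXn mulnC eqn_pmul2l // [_ == _](_ : _ = false) ?mul0rn //.
apply/negbTE; apply: contra ne_j => /eqP E; apply/eqP/val_inj => /=; move: E.
by have := ltn_ord j; lia.
Qed.

(** ['C(p ^ a * q, i * p ^ a)] and ['C(q, i)] are congruent modulo [p], as the
    coefficients of [X ^ (i * p ^ a)] in [(1 + X) ^ (p ^ a * q)] and in
    [(1 + X ^ (p ^ a)) ^ q]. *)
Lemma prime_ndvd_bin_mulXn p a q i :
  prime p -> ~~ (p %| 'C(q, i))%N -> ~~ (p %| 'C(p ^ a * q, i * p ^ a))%N.
Proof.
move=> p_pr; apply: contra => dvd_p.
have [u] := congr_modn_exp q (congr_modn_exprD1X a 1 p_pr).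
move/(congr1 (fun f : {poly int} => f`_(i * p ^ a))).
rewrite -exprM mul1n coefD coefMn coef_exp1Xn ?expn_gt0 ?prime_gt0 //.
have := @coef_exp1Xn 1 (p ^ a * q) (i * p ^ a) isT; rewrite muln1 => ->.
move=> /eqP; rewrite -subr_eq => /eqP E.
suff : (p%:Z %| 'C(q, i)%:Z)%Z by [].
rewrite -[X in (_ %| X)%Z]natz -E rpredB //; first by rewrite natz.
by rewrite -mulr_natr natz dvdz_mull.
Qed.

(** The last [D] digits of [q] in base [p] are all [p.-1].  For
    [0 < k < p ^ D], [p] divides ['C(q.+1, k)], because
    [k * 'C(q.+1, k) = q.+1 * 'C(q, k.-1)] is divisible by [p ^ D] while [k] is
    not; Pascal's rule then propagates non-divisibility from ['C(q, i)] to
    ['C(q, i.+1)]. *)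
Lemma prime_ndvd_bin_pred p D q i :
  prime p -> (p ^ D %| q.+1)%N -> (i < p ^ D)%N -> ~~ (p %| 'C(q, i))%N.
Proof.
move=> p_pr pDq; elim: i => [|i IHi] lt_i; first by rewrite bin0 Euclid_dvd1.
have dvd_p : (p %| 'C(q.+1, i.+1))%N.
  apply/negPn/negP; rewrite -prime_coprime // => cop.
  have : (p ^ D %| i.+1 * 'C(q.+1, i.+1))%N.
    by rewrite -mul_bin_diag dvdn_mulr.
  by rewrite Gauss_dvdl ?coprimeXl // => /dvdn_leq; lia.
move: dvd_p; rewrite binS => dvd_p; apply: contra (IHi (ltnW lt_i)) => dvd_i.
by rewrite -(dvdn_addr _ dvd_i).
Qed.

(** * Markov chains driving a random walk on an abelian group *)

Section MarkovSums.
Variables (R : realFieldType) (A : finZmodType) (B : zmodType).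
Variables (P : A -> A -> R) (phi : nat -> A -> B).

(** Backward transfer operator: if the letter at coordinate [k.-1] is [a] and
    the sum accumulated so far is [w], it is the expectation of [v] after the
    letters at the [l] coordinates from [k] on have been drawn and their values
    under [phi] added to [w]. *)
Fixpoint transfer (k l : nat) (v : A -> B -> R) (a : A) (w : B) : R :=
  if l is l'.+1 then \sum_b P a b * transfer k.+1 l' v b (w + phi k b)
  else v a w.

Definition increment (h : B) (v : A -> B -> R) (a : A) (w : B) : R :=
  v a (w + h) - v a w.

Lemma transfer_addn k l1 l2 v a w :
  transfer k (l1 + l2) v a w = transfer k l1 (transfer (k + l1) l2 v) a w.
Proof.
elim: l1 k a w => [|l1 IHl] k a w; first by rewrite addn0.
by rewrite /=; apply: eq_bigr => b _; rewrite IHl addnS.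
Qed.

Lemma transfer_increment k l h v a w :
  increment h (transfer k l v) a w = transfer k l (increment h v) a w.
Proof.
elim: l k a w => [|l IHl] k a w //=; rewrite /increment /=.
rewrite -sumrB; apply: eq_bigr => b _.
by rewrite -mulrBr addrAC -IHl.
Qed.

Lemma transfer_shift k l h v a w :
  transfer k l (fun b u => v b (u + h)) a w = transfer k l v a (w + h).
Proof.
elim: l k a w => [|l IHl] k a w //=.
by apply: eq_bigr => b _; rewrite IHl addrAC.
Qed.

Hypothesis P_ge0 : forall a b, 0 <= P a b.
Hypothesis P_sum1 : forall a, \sum_b P a b = 1.

Lemma transfer_subl k l v c a w :
  transfer k l (fun a w => c - v a w) a w = c - transfer k l v a w.
Proof.
elim: l k a w => [|l IHl] k a w //=.
under eq_bigr do rewrite IHl mulrBr.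
by rewrite sumrB -mulr_suml P_sum1 mul1r.
Qed.

Lemma transfer_ge0 k l v a w :
  (forall a w, 0 <= v a w) -> 0 <= transfer k l v a w.
Proof.
move=> v_ge0; elim: l k a w => [|l IHl] k a w //=.
by apply: sumr_ge0 => b _; rewrite mulr_ge0.
Qed.

Lemma transfer_le k l v c a w :
  (forall a w, v a w <= c) -> transfer k l v a w <= c.
Proof.
move=> v_le; rewrite -subr_ge0 -transfer_subl.
by apply: transfer_ge0 => b u; rewrite subr_ge0.
Qed.

Variables (M : rel A) (eps : R).
Hypothesis eps_ge0 : 0 <= eps.
Hypothesis P_ge_eps : forall a b, M a b -> eps <= P a b.

Lemma transfer_ge_path k l v (x : nat -> A) w :
  (forall a w, 0 <= v a w) -> (forall i, (i < l)%N -> M (x i) (x i.+1)) ->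
  eps ^+ l * v (x l) (w + \sum_(i < l) phi (k + i) (x i.+1))
    <= transfer k l v (x 0%N) w.
Proof.
move=> v_ge0; elim: l k x w => [|l IHl] k x w Mx /=.
  by rewrite big_ord0 addr0 mul1r.
rewrite (bigD1 (x 1%N)) //= ler_wpDr ?sumr_ge0 // => [b _|].
  by rewrite mulr_ge0 ?transfer_ge0.
rewrite exprS -mulrA ler_pM ?P_ge_eps ?Mx // ?mulr_ge0 ?exprn_ge0 //.
have := IHl k.+1 (fun i => x i.+1) (w + phi k (x 1%N)) (fun i => Mx i.+1).
rewrite big_ord_recl addn0 addrA.
by under [in X in X -> _]eq_bigr do rewrite addSnnS.
Qed.

Hypothesis M_add : forall a b c d, M a b -> M c d -> M (a + c) (b + d).
Hypothesis M_succ : forall a, exists b, M a b.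
Hypothesis phi_additive : forall k a b, phi k (a + b) = phi k a + phi k b.

(** [y 0] and [y l] are the letters at coordinates [k.-1] and [k + l - 1]; both
    vanish, so a loop can be added to a path without changing the letters
    through which it communicates with the other coordinates. *)
Definition has_loop (k l : nat) (h : B) : Prop :=
  exists y : nat -> A,
    [/\ y 0%N = 0, y l = 0, forall i, (i < l)%N -> M (y i) (y i.+1) &
        \sum_(i < l) phi (k + i) (y i.+1) = h].

(** The increments along the orbit [u, u + h, u + h *+ 2, ...] telescope over a
    full period to 0, so one of them is at most 0.  Adding that many copies of
    the loop to any admissible path gives a path of weight at least [eps ^+ l]
    on which the nonnegative function [c - increment h v] is at least [c]. *)
Lemma transfer_contract_upper k l h N v c a w :
  (0 < N)%N -> h *+ N = 0 -> has_loop k l h ->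
  (forall a w, increment h v a w <= c) ->
  increment h (transfer k l v) a w <= (1 - eps ^+ l) * c.
Proof.
move=> N_gt0 hN [y [y0 yl My sum_y]] v_le.
pose succ a : A := odflt 0 [pick b | M a b].
have M_succP b : M b (succ b).
  rewrite /succ; case: pickP => // noM; have [d] := M_succ b.
  by rewrite noM.
pose x i := iter i succ a.
have Mxy j i : (i < l)%N -> M (x i + y i *+ j) (x i.+1 + y i.+1 *+ j).
  move=> lt_il; elim: j => [|j IHj]; first by rewrite !mulr0n !addr0 M_succP.
  by rewrite !mulrSr !addrA M_add // My.
have sum_xy j : \sum_(i < l) phi (k + i) (x i.+1 + y i.+1 *+ j) =
    \sum_(i < l) phi (k + i) (x i.+1) + h *+ j.
  elim: j => [|j IHj].
    by rewrite addr0; apply: eq_bigr => i _; rewrite mulr0n addr0.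
  rewrite mulrSr addrA -IHj -sum_y -big_split; apply: eq_bigr => i _ /=.
  by rewrite -phi_additive -addrA -mulrSr.
set u := w + \sum_(i < l) phi (k + i) (x i.+1).
(* The increments telescope, and [h *+ N = 0] closes the orbit. *)
have sum0 : \sum_(0 <= j < N) increment h v (x l) (u + h *+ j) = 0.
  under eq_bigr do rewrite /increment -addrA -mulrSr.
  by rewrite telescope_sumr // hN mulr0n subrr.
have [j j_le0] : exists j, increment h v (x l) (u + h *+ j) <= 0.
  have [/existsP[j ?]|/existsPn noj] :=
    boolP [exists j : 'I_N, increment h v (x l) (u + h *+ j) <= 0].
    by exists j.
  suff: 0 < \sum_(0 <= j < N) increment h v (x l) (u + h *+ j).
    by rewrite sum0 ltxx.
  case: N N_gt0 noj {hN sum0} => // N _ noj; rewrite big_mkord big_ord_recl.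
  by rewrite ltr_wpDr ?sumr_ge0 // => [i _|]; rewrite ?ltW // ltNge noj.
rewrite transfer_increment.
have /(_ _ (Mxy j)) := @transfer_ge_path k l
  (fun a w => c - increment h v a w) (fun i => x i + y i *+ j) w.
rewrite transfer_subl /= y0 mul0rn addr0 yl mul0rn addr0 sum_xy addrA -/u.
have v_ge0 b z : 0 <= c - increment h v b z by rewrite subr_ge0.
move=> /(_ v_ge0) H; rewrite mulrBl mul1r lerBrDl -lerBrDr.
by apply: le_trans H; rewrite ler_wpM2l ?exprn_ge0 // lerBrDl gerDr.
Qed.

Lemma transfer_increment_le k l h v c a w :
  (forall a w, increment h v a w <= c) ->
  increment h (transfer k l v) a w <= c.
Proof. by rewrite transfer_increment => v_le; apply: transfer_le. Qed.

(** Loops repeated with period [T]: each period consists of a stretch of length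
    [l] that contracts the increments and an idle stretch of length [T - l] that
    does not enlarge them. *)
Lemma transfer_contract k l h N T D v c a w :
  (0 < N)%N -> h *+ N = 0 -> (l <= T)%N ->
  (forall i, (i < D)%N -> has_loop (k + i * T) l h) ->
  (forall a w, increment h v a w <= c) ->
  increment h (transfer k (D * T) v) a w <= (1 - eps ^+ l) ^+ D * c.
Proof.
move=> N_gt0 hN le_lT; elim: D k a w => [|D IHD] k a w loops v_le.
  by rewrite expr0 mul1r mul0n.
have T_eq : T = (l + (T - l))%N by rewrite subnKC.
rewrite mulSn {1}T_eq -addnA exprS -mulrA /increment !transfer_addn.
apply: transfer_contract_upper N_gt0 hN _ _.
  by have := loops 0%N isT; rewrite addn0.
move=> b u; rewrite /increment !transfer_addn.
apply: transfer_increment_le => {}b {}u; rewrite -addnA subnKC //.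
by apply: IHD => // i lt_iD; have := loops i.+1 lt_iD; rewrite mulSn addnA.
Qed.

(** Same as [transfer_contract], with idle stretches before the first loop and
    after the last one. *)
Lemma transfer_mixing k j l h N T D K v c a w :
  (0 < N)%N -> h *+ N = 0 -> (l <= T)%N -> (j + D * T <= K)%N ->
  (forall i, (i < D)%N -> has_loop (k + j + i * T) l h) ->
  (forall a w, increment h v a w <= c) ->
  increment h (transfer k K v) a w <= (1 - eps ^+ l) ^+ D * c.
Proof.
move=> N_gt0 hN le_lT /subnKC <- loops v_le.
rewrite -addnA /increment !transfer_addn.
apply: transfer_increment_le => {}a {}w; rewrite /increment !transfer_addn.
apply: transfer_contract N_gt0 hN le_lT loops _ => b u.
exact: transfer_increment_le.
Qed.

End MarkovSums.

(** * Paths and gluing in a Markov subgroup *)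

Section MarkovSubgroup.
Variables (A : finZmodType) (M : rel A).

Definition walk (r : nat) (a b : A) : Prop :=
  exists f : nat -> A,
    [/\ f 0%N = a, f r = b & forall i, (i < r)%N -> M (f i) (f i.+1)].

Lemma walk_cons r a b c : M a b -> walk r b c -> walk r.+1 a c.
Proof.
move=> Mab [f [f0 fr Mf]]; exists (fun i => if i is i'.+1 then f i' else a).
by split=> // -[|i] //; [rewrite f0 | exact: Mf].
Qed.

Lemma incidence_mx_exp_walk n i j :
  (0 < (incidence_mx M ^+ n) i j)%N -> walk n (enum_val i) (enum_val j).
Proof.
elim: n i => [|n IHn] i.
  rewrite expr0 mxE; case: eqP => // -> _.
  by exists (fun=> enum_val j).
rewrite exprS mxE lt0n sum_nat_eq0 negb_forall => /existsP[k].
rewrite implyTb muln_eq0 negb_or mxE eqb0 negbK -lt0n => /andP[Mik Mkj].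
exact: walk_cons Mik (IHn _ Mkj).
Qed.

Lemma irreducible_walk0 : irreducible_incidence M ->
  exists2 n, (0 < n)%N & forall b, walk n 0 b.
Proof.
move=> [n n_gt0 /setP full]; exists n => // b.
have := full b; rewrite !inE => /incidence_mx_exp_walk.
by rewrite !enum_rankK.
Qed.

Hypothesis M_succ : forall a, exists b, M a b.
Hypothesis M_irr : irreducible_incidence M.
Hypothesis M_grp : markov_subgroup M.

Lemma incidence_pred b : exists a, M a b.
Proof.
have [[//|n] _ /(_ b)[f [_ <- Mf]]] := irreducible_walk0 M_irr.
by exists (f n); apply: Mf.
Qed.

Lemma markov_shift0 : markov_shift M 0.
Proof. by case: M_grp => /set_mem. Qed.

Lemma markov_shiftB x y :
  markov_shift M x -> markov_shift M y -> markov_shift M (x - y).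
Proof.
by move=> Mx My; case: M_grp => _ /(_ x y (mem_set Mx) (mem_set My)) /set_mem.
Qed.

Lemma markov_shiftD x y :
  markov_shift M x -> markov_shift M y -> markov_shift M (x + y).
Proof.
move=> Mx My; rewrite -[y]opprK -[- y]sub0r.
exact: markov_shiftB Mx (markov_shiftB markov_shift0 My).
Qed.

(** A finite admissible word extends to the right because every letter has a
    successor, and to the left because, by irreducibility, every letter has a
    predecessor. *)
Lemma markov_shift_extend (f : nat -> A) l :
  (forall i, (i < l)%N -> M (f i) (f i.+1)) ->
  exists2 x, markov_shift M x & forall i : nat, (i <= l)%N -> x i%:Z = f i.
Proof.
move=> Mf; have [succ M_s] := choice M_succ; have [prd M_p] := choice incidence_pred.
exists (fun i : int => match i with
  | Posz k => if (k <= l)%N then f k else iter (k - l) succ (f l)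
  | Negz k => iter k.+1 prd (f 0%N) end) => [i|i -> //].
case: i => [k|[|k]].
- rewrite -PoszD addn1; case: (ltngtP k l) => [lt_kl|lt_lk|->]; first exact: Mf.
    by rewrite subSn ?(ltnW lt_lk) //=; apply: M_s.
  by rewrite subSnn; apply: M_s.
- rewrite NegzE addNr /=; exact: M_p.
- rewrite NegzE (_ : - k.+2%:Z + 1 = Negz k); last by rewrite NegzE; lia.
  exact: M_p.
Qed.

(** The subgroup property, which concerns bi-infinite configurations, descends
    to pairs of letters: extend both pairs and subtract the extensions. *)
Lemma incidenceB a b c d : M a b -> M c d -> M (a - c) (b - d).
Proof.
move=> Mab Mcd.
pose pair u v i : A := if i is 0%N then u else v.
have M_pair u v : M u v -> forall i, (i < 1)%N -> M (pair u v i) (pair u v i.+1).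
  by move=> Muv [].
have [x Mx xE] := markov_shift_extend (M_pair _ _ Mab).
have [y My yE] := markov_shift_extend (M_pair _ _ Mcd).
have := markov_shiftB Mx My 0; rewrite add0r.
by rewrite -[(x - y) 0]/(x 0 - y 0) -[(x - y) 1]/(x 1 - y 1)
  (xE 0%N) ?(xE 1%N) ?(yE 0%N) ?(yE 1%N).
Qed.

Lemma incidence00 : M 0 0.
Proof. exact: (markov_shift0 0). Qed.

Lemma incidenceD a b c d : M a b -> M c d -> M (a + c) (b + d).
Proof.
move=> Mab Mcd; rewrite -[c]opprK -[d]opprK -[- c]sub0r -[- d]sub0r.
exact: incidenceB Mab (incidenceB incidence00 Mcd).
Qed.

(** Irreducibility only provides paths starting at 0.  To go from [a] to [b],
    follow any admissible path from [a], ending at [c], say, and add to it a path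
    of the same length from 0 to [b - c]. *)
Lemma irreducible_walk : exists2 r, (0 < r)%N & forall a b, walk r a b.
Proof.
have [r r_gt0 walk0] := irreducible_walk0 M_irr; exists r => // a b.
have [x Mx x0] := @markov_shift_extend (fun=> a) 0 (fun i => ltac:(by [])).
have [f [f0 fr Mf]] := walk0 (b - x r%:Z).
exists (fun i => x i%:Z + f i); split=> [||i lt_ir].
- by rewrite f0 addr0 x0.
- by rewrite fr addrC subrK.
- by apply: incidenceD (Mf i lt_ir); have := Mx i%:Z; rewrite -PoszD addn1.
Qed.

Lemma markov_shift_glue r c x z :
  (0 < r)%N -> (forall a b, walk r a b) ->
  markov_shift M x -> markov_shift M z ->
  exists u, [/\ markov_shift M u, forall i, i <= c -> u i = x i &
    forall i, c + r%:Z <= i -> u i = z i].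
Proof.
move=> r_gt0 M_walk Mx Mz; have [f [f0 fr Mf]] := M_walk (x c) (z (c + r%:Z)).
pose u i := if i <= c then x i else if c + r%:Z <= i then z i
            else f `|i - c|%N.
have uL i : i <= c -> u i = x i by rewrite /u => ->.
have uR i : c + r%:Z <= i -> u i = z i.
  by move=> le_i; rewrite /u le_i; case: ifP => //; lia.
have uM (j : nat) : (j <= r)%N -> u (c + j%:Z) = f j.
  move=> le_jr; have [->|j_gt0] := posnP j; first by rewrite addr0 uL // f0.
  have [->|lt_jr] := eqVneq j r; first by rewrite uR // fr.
  rewrite /u; case: ifP => [|_]; first by lia.
  by case: ifP => [?|_]; [exfalso; lia | congr f; lia].
exists u; split=> // i; have [lt_ic|le_ci] := ltP i c.
  by rewrite !uL; [exact: Mx | lia | lia].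
have [le_ri|lt_ir] := leP (c + r%:Z) i.
  by rewrite !uR; [exact: Mz | lia | lia].
have -> : i = c + `|i - c|%N%:Z by lia.
rewrite -addrA -PoszD addn1 !uM; [|lia|lia].
by apply: Mf; lia.
Qed.

(** [Phi y = x] reads [y (i + 1) = x i - y i], which determines [y] from left to
    right once [y] vanishes far to the left.  Admissibility propagates: the pair
    at [(i, i + 1)] is the pair of [x] at [(i - 1, i)] minus the pair of [y]
    there. *)
Lemma Phi_section x c : markov_shift M x -> (forall i, i < c -> x i = 0) ->
  exists y, [/\ markov_shift M y, forall i, i <= c -> y i = 0 & Phi y = x].
Proof.
move=> Mx x0.
pose fix z (k : nat) : A := if k is k'.+1 then x (c + k'%:Z) - z k' else 0.
pose y i : A := if i <= c then 0 else z `|i - c|%N.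
have y0 i : i <= c -> y i = 0 by rewrite /y => ->.
have yz (k : nat) : y (c + k%:Z) = z k.
  case: k => [|k]; first by rewrite y0 ?addr0.
  by rewrite /y; case: ifP => [?|_]; [exfalso; lia | congr z; lia].
have yx i : y (i + 1) = x i - y i.
  have [lt_ic|le_ci] := ltP i c; first by rewrite !y0 ?x0 ?subr0 //; lia.
  have -> : i = c + `|i - c|%N%:Z by lia.
  by rewrite -addrA -PoszD addn1 !yz.
exists y; split=> //; last first.
  by apply/funext => i; rewrite -[LHS]/(y i + y (i + 1)) yx addrC subrK.
suff My (k : nat) : forall i, i <= c + k%:Z -> M (y i) (y (i + 1)).
  by move=> i; apply: (My `|i - c|%N); lia.
elim: k => [|k IHk] i le_ic.
  have [lt_ic|le_ci] := ltP i c; first by rewrite !y0; [exact: incidence00|lia|lia].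
  rewrite yx y0; last by lia.
  have -> : i = c by lia.
  have := Mx (c - 1); rewrite subrK subr0 x0 //; lia.
have y_i : y i = x (i - 1) - y (i - 1) by rewrite -yx subrK.
rewrite yx {1}y_i; apply: incidenceB; first by have := Mx (i - 1); rewrite subrK.
by have := IHk (i - 1); rewrite subrK; apply; lia.
Qed.

End MarkovSubgroup.

(** * Integer polynomials acting on configurations *)

Section PolynomialAction.
Variable A : finZmodType.
Implicit Types (x : AZ A) (q : {poly int}).

(** The variable acts as the shift, so [1 + 'X] acts as [Phi]; congruences between
    powers of [1 + 'X] thus become identities between iterates of [Phi]. *)
Definition poly_act q x : AZ A := fun i => \sum_(k < size q) x (i + k%:Z) *~ q`_k.

Lemma poly_act_wide N q x i : (size q <= N)%N ->
  poly_act q x i = \sum_(k < N) x (i + k%:Z) *~ q`_k.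
Proof.
move=> le_qN; rewrite /poly_act (big_ord_widen N (fun k => x (i + k%:Z) *~ q`_k)) //.
rewrite big_mkcond; apply: eq_bigr => k _; case: ltnP => // le_qk.
by rewrite nth_default // mulr0z.
Qed.

Lemma poly_actD p q x i : poly_act (p + q) x i = poly_act p x i + poly_act q x i.
Proof.
rewrite !(@poly_act_wide (maxn (size p) (size q))) ?leq_maxl ?leq_maxr ?size_polyD //.
by rewrite -big_split; apply: eq_bigr => k _; rewrite coefD mulrzDr.
Qed.

Lemma poly_actC (c : int) x i : poly_act c%:P x i = x i *~ c.
Proof.
by rewrite (@poly_act_wide 1) ?size_polyC ?leq_b1 // big_ord1 addr0 coefC.
Qed.

Lemma poly_actMX q x i : poly_act (q * 'X) x i = poly_act q x (i + 1).
Proof.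
rewrite (@poly_act_wide (size q).+1); last first.
  by apply: leq_trans (size_polyMleq _ _) _; rewrite size_polyX addnC.
rewrite big_ord_recl coefMX mulr0z add0r; apply: eq_bigr => k _.
by rewrite coefMX /= /bump /= add1n -addrA -PoszD add1n.
Qed.

Lemma poly_actCM (c : int) q x i : poly_act (c%:P * q) x i = poly_act q x i *~ c.
Proof.
rewrite (@poly_act_wide (size q)) ?mul_polyC ?size_scale_leq // /poly_act.
rewrite (big_morph (fun y => y *~ c) (mulrzDl c) (mul0rz _ c)).
by apply: eq_bigr => k _; rewrite coefZ mulrC mulrzA.
Qed.

Lemma poly_actM p q x i : poly_act (p * q) x i = poly_act p (poly_act q x) i.
Proof.
elim/poly_ind: p i => [|p c IHp] i.
  by rewrite mul0r /poly_act size_poly0 !big_ord0.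
rewrite mulrDl !poly_actD poly_actC poly_actCM -mulrA ['X * q]mulrC mulrA.
by rewrite !poly_actMX IHp.
Qed.

Lemma poly_act_congr_modn N p q x i : (forall a : A, a *+ N = 0) ->
  congr_modn N p q -> poly_act p x i = poly_act q x i.
Proof.
move=> AN [u ->]; rewrite poly_actD [X in _ + X]big1 ?addr0 //= => -[k ? _] /=.
by rewrite coefMn -[_ *+ N]mulr_natl natz mulrzA -pmulrn AN mul0rz.
Qed.

(** The action of [1 + 'X^L]; for [L = 1] it is [Phi]. *)
Definition gap_sum (L : nat) (x : AZ A) : AZ A := fun i => x i + x (i + L%:Z).

Lemma iter_gap_sum L n x i :
  iter n (gap_sum L) x i = \sum_(j < n.+1) x (i + (j * L)%N%:Z) *+ 'C(n, j).
Proof.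
elim: n i => [|n IHn] i; first by rewrite big_ord1 addr0.
rewrite iterS {1}/gap_sum !IHn.
rewrite big_ord_recl [RHS]big_ord_recl !bin0 -addrA; congr (_ + _).
under [RHS]eq_bigr do rewrite /bump /= binS mulrnDr.
rewrite big_split; congr (_ + _).
  rewrite [RHS]big_ord_recr /= bin_small // mulr0n addr0.
  by apply: eq_bigr.
by apply: eq_bigr => j _; rewrite mulSn PoszD addrA.
Qed.

Lemma Phi_gap_sum n x : iter n (@Phi A) x = iter n (gap_sum 1) x.
Proof. by []. Qed.

Lemma iter_Phi n x i :
  iter n (@Phi A) x i = \sum_(j < n.+1) x (i + j%:Z) *+ 'C(n, j).
Proof.
by rewrite Phi_gap_sum iter_gap_sum; under eq_bigr do rewrite muln1.
Qed.

Lemma poly_act_gap_sum L n x : poly_act ((1 + 'X^L) ^+ n) x = iter n (gap_sum L) x.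
Proof.
have act1 y : poly_act (1 + 'X^L) y = gap_sum L y.
  apply/funext => i; rewrite poly_actD (poly_actC 1) mulr1z; congr (_ + _).
  elim: L i => [|L IHL] i; first by rewrite (poly_actC 1) addr0.
  by rewrite exprSr poly_actMX IHL -addrA -PoszD add1n.
elim: n => [|n IHn]; apply/funext => i; first by rewrite (poly_actC 1).
by rewrite exprS poly_actM IHn act1.
Qed.
End PolynomialAction.

(** * Loops and their contribution to a window of the iterates *)

Section Coefficients.
Variable A : finZmodType.
Implicit Types (x : AZ A).

Definition window (m : nat) x : {ffun 'I_m -> A} :=
  [ffun i : 'I_m => x (i : nat)%:Z].

(** The contribution of the letter [a] at coordinate [k] to the window
    [0, ..., m - 1] of the [n]-th iterate of [Phi]. *)
Definition window_coef (n m k : nat) (a : A) : {ffun 'I_m -> A} :=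
  [ffun i : 'I_m => if (i <= k)%N then a *+ 'C(n, k - i) else 0].

Lemma window_coefD n m k a b :
  window_coef n m k (a + b) = window_coef n m k a + window_coef n m k b.
Proof.
by apply/ffunP => i; rewrite !ffunE; case: ifP; rewrite ?mulrnDl ?addr0.
Qed.

Lemma window_iter_Phi n m K x : (n + m <= K)%N ->
  window m (iter n (@Phi A) x) = \sum_(0 <= t < K) window_coef n m t (x t%:Z).
Proof.
move=> le_K; apply/ffunP => i; rewrite sum_ffunE ffunE iter_Phi.
have lt_im := ltn_ord i.
rewrite (@big_cat_nat _ _ _ (i + n.+1)%N) //=; last by lia.
rewrite [X in _ + X]big1_seq ?addr0; last first.
  move=> t /andP[_]; rewrite mem_index_iota => /andP[le_t _]; rewrite ffunE.
  by case: ifP => // _; rewrite bin_small ?mulr0n //; lia.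
rewrite (@big_cat_nat _ _ _ i) //=; last by lia.
rewrite [X in X + _]big1_seq ?add0r; last first.
  move=> t /andP[_]; rewrite mem_index_iota => /andP[_ lt_t]; rewrite ffunE.
  by case: ifP => // ?; lia.
rewrite -[index_iota i _]/(index_iota (0 + i) (i + n.+1)) big_addn addKn big_mkord.
by apply: eq_bigr => t _; rewrite ffunE leq_addl addnK addnC PoszD.
Qed.

Lemma window_iter_Phi_supp n m k l x :
  (forall i, i < k%:Z -> x i = 0) -> (forall i, (k + l)%N%:Z <= i -> x i = 0) ->
  window m (iter n (@Phi A) x) = \sum_(i < l) window_coef n m (k + i) (x (k + i)%N%:Z).
Proof.
have coef0 t : window_coef n m t 0 = 0.
  by apply/ffunP => i; rewrite !ffunE mul0rn if_same.
move=> xL xR; rewrite (@window_iter_Phi _ _ (k + l + (n + m))) ?leq_addl //.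
rewrite (@big_cat_nat _ _ _ (k + l)) //=; last by lia.
rewrite [X in _ + X]big1_seq ?addr0; last first.
  by move=> t /andP[_]; rewrite mem_index_iota => /andP[le_t _]; rewrite xR // lez_nat.
rewrite (@big_cat_nat _ _ _ k) //=; last by lia.
rewrite [X in X + _]big1_seq ?add0r; last first.
  by move=> t /andP[_]; rewrite mem_index_iota => /andP[_ lt_t]; rewrite xL.
rewrite -[index_iota k _]/(index_iota (0 + k) (k + l)) big_addn addKn big_mkord.
by apply: eq_bigr => t _; rewrite addnC.
Qed.

End Coefficients.

Section Loops.
Variables (A : finZmodType) (M : rel A).
Hypothesis M_succ : forall a, exists b, M a b.
Hypothesis M_irr : irreducible_incidence M.
Hypothesis M_grp : markov_subgroup M.

Variable r : nat.
Hypothesis r_gt0 : (0 < r)%N.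
Hypothesis M_walk : forall a b, walk M r a b.

(** Cut [h] off far to the left, solve for an [n]-fold preimage under [Phi] from
    left to right, each step moving the start of the support one unit to the
    right, and cut the solution off to the right of the coordinates on which the
    window depends. *)
Lemma markov_shift_local_preimage n m h : markov_shift M h ->
  exists y, [/\ markov_shift M y,
    forall i, i <= n%:Z - r%:Z -> y i = 0,
    forall i, (n + m + r)%N%:Z <= i -> y i = 0 &
    forall i : nat, (i < m)%N -> iter n (@Phi A) y i%:Z = h i%:Z].
Proof.
move=> Mh; have M0 := markov_shift0 M_grp.
have [u [Mu u0 uh]] := markov_shift_glue (- r%:Z) r_gt0 M_walk M0 Mh.
have [y [My y0 yu]] : exists y, [/\ markov_shift M y,
    forall i, i <= n%:Z - r%:Z -> y i = 0 & iter n (@Phi A) y = u].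
  elim: n => [|n [y [My y0 yu]]].
    by exists u; split=> // i; rewrite sub0r; apply: u0.
  have lt_y0 i : i < n%:Z - r%:Z + 1 -> y i = 0 by move=> ?; apply: y0; lia.
  have [z [Mz z0 zy]] := Phi_section M_succ M_irr M_grp My lt_y0.
  exists z; split=> // [i ?|]; first by apply: z0; lia.
  by rewrite iterSr zy.
have [z [Mz zy z0]] := markov_shift_glue (n + m)%N%:Z r_gt0 M_walk My M0.
exists z; split=> // [i le_i|i lt_im].
  by rewrite zy ?y0 //; lia.
rewrite -[h _]uh; last by lia.
rewrite -yu !iter_Phi; apply: eq_bigr => j _; rewrite zy //.
by have := ltn_ord j; lia.
Qed.

Variables (p s : nat).
Hypothesis p_pr : prime p.
Hypothesis A_tors : forall a : A, a *+ (p ^ s.+1)%N = 0.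

(** Torsion turns the congruence [congr_modn_exp1X] into an equality of
    operators. *)
Lemma iter_Phi_split k n Q x :
  iter (n + p ^ k * (p ^ s * Q)) (@Phi A) x =
  iter (p ^ s * Q) (gap_sum (p ^ k)) (iter n (@Phi A) x).
Proof.
rewrite (addnC n) iterD; set z := iter n _ x.
rewrite Phi_gap_sum -!poly_act_gap_sum; apply/funext => i.
apply: poly_act_congr_modn A_tors _; rewrite mulnA expr1 !exprM.
by apply: congr_modn_exp; rewrite -exprM; apply: congr_modn_exp1X.
Qed.

(** The outer operator sums translates by multiples of [p ^ k].  As
    [n + m + r <= p ^ k], moving the window by a nonzero multiple of [p ^ k]
    takes it off the support of [iter n Phi y]; only the translate that brings
    [y] back to its place contributes. *)
Lemma window_iter_Phi_translate k n m Q j y :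
  (n + m + r <= p ^ k)%N -> (j <= p ^ s * Q)%N ->
  (forall i, i <= n%:Z - r%:Z -> y i = 0) ->
  (forall i, (n + m + r)%N%:Z <= i -> y i = 0) ->
  window m (iter (n + p ^ k * (p ^ s * Q)) (@Phi A)
                 (fun i => y (i - (j * p ^ k)%N%:Z))) =
  window m (iter n (@Phi A) y) *+ 'C(p ^ s * Q, j).
Proof.
set L := (p ^ k)%N => le_L; rewrite -ltnS => lt_j yL yR; apply/ffunP => i.
rewrite ffunMnE !ffunE iter_Phi_split iter_gap_sum -/L.
rewrite (bigD1 (Ordinal lt_j)) //= big1 ?addr0 => [|j' ne_jj'].
  congr (_ *+ _); rewrite !iter_Phi; apply: eq_bigr => t _.
  by congr (y _ *+ _); lia.
have lt_i := ltn_ord i; rewrite iter_Phi big1 ?mul0rn // => t _.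
have lt_t := ltn_ord t; suff -> : y (i%:Z + (j' * L)%N%:Z + t%:Z - (j * L)%N%:Z) = 0.
  by rewrite mul0rn.
case: (ltngtP j j') => [lt_jj|lt_jj|eq_jj].
- apply: yR; have : (j.+1 * L <= j' * L)%N by rewrite leq_mul2r lt_jj orbT.
  by rewrite mulSn; lia.
- apply: yL; have : (j'.+1 * L <= j * L)%N by rewrite leq_mul2r lt_jj orbT.
  by rewrite mulSn; lia.
by case/eqP: ne_jj'; apply/val_inj.
Qed.

(** On a group of exponent dividing [p ^ s.+1], multiplication by an integer
    prime to [p] is invertible, by Bezout. *)
Lemma coprime_mulrn_inverse c : coprime (p ^ s.+1) c ->
  exists u, forall a : A, a *+ u *+ c = a.
Proof.
move=> cop; have [c0|c_gt0] := posnP c.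
  by move: cop; rewrite c0 /coprime gcdn0 -(expn0 p) eqn_exp2l ?prime_gt1.
have [u v /= E _] := egcdnP (p ^ s.+1) c_gt0.
exists u => a; rewrite -mulrnA E mulrnDr mulnC mulrnA A_tors mul0rn add0r.
by move: cop; rewrite coprime_sym /coprime => /eqP ->.
Qed.

(** The loop is the translate by [i * p ^ s * p ^ k] of a local preimage of a
    multiple of [h], the multiple being chosen to cancel the binomial coefficient
    ['C(p ^ s * q, i * p ^ s)]. *)
Lemma has_loop_iter_Phi n k E q i m h :
  (p ^ E %| q.+1)%N -> (i < p ^ E)%N -> (0 < i <= q)%N ->
  (n + m + r <= p ^ k)%N -> markov_shift M h ->
  has_loop (window_coef (n + p ^ k * (p ^ s * q)) m) M
    (n + i * (p ^ s * p ^ k) - r).+1 (m + r + r) (window m h).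
Proof.
move=> dvd_q lt_i /andP[i_gt0 le_iq] le_L Mh.
have /(prime_ndvd_bin_mulXn s p_pr) := prime_ndvd_bin_pred p_pr dvd_q lt_i.
rewrite -prime_coprime // => /(coprimeXl s.+1) /coprime_mulrn_inverse[u uK].
have Mhu : markov_shift M (h *+ u).
  elim: u {uK} => [|u IHu]; first exact: markov_shift0.
  by rewrite mulrSr; apply: markov_shiftD.
have [y [My yL yR yh]] := markov_shift_local_preimage n m Mhu.
set c := (n + i * (p ^ s * p ^ k) - r)%N.
have ge_r : (p ^ k <= i * (p ^ s * p ^ k))%N.
  by rewrite mulnA leq_pmull // muln_gt0 i_gt0 expn_gt0 prime_gt0.
have le_j : (i * p ^ s <= p ^ s * q)%N by rewrite mulnC leq_mul2l le_iq orbT.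
have := window_iter_Phi_translate le_L le_j yL yR.
set z := (fun _ : int => y _) => zE.
exists (fun t => z (c + t)%N%:Z); split.
- by rewrite addn0 /z yL //; rewrite /c; lia.
- by rewrite /z yR //; rewrite /c; lia.
- move=> t _; rewrite /z; have := My ((c + t)%N%:Z - (i * p ^ s * p ^ k)%N%:Z).
  by congr (M _ (y _)); lia.
transitivity (window m (iter (n + p ^ k * (p ^ s * q)) (@Phi A) z)).
  rewrite (@window_iter_Phi_supp _ _ _ c.+1 (m + r + r)).
  - by apply: eq_bigr => t _; rewrite addSnnS.
  - by move=> t lt_t; rewrite /z yL //; rewrite /c in lt_t; lia.
  - by move=> t lt_t; rewrite /z yR //; rewrite /c in lt_t; lia.
rewrite zE; apply/ffunP => t; rewrite ffunMnE !ffunE yh //.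
rewrite -[RHS]uK; congr (_ *+ _).
by elim: (u) => [|v IHv]; rewrite ?mulr0n // !mulrSr -IHv.
Qed.

End Loops.

(** * Events depending on finitely many coordinates *)

Section FiniteObservables.
Variables (R : realType) (A : finZmodType).

(** A function with finitely many values whose fibres are events; the functions
    of finitely many coordinates are of this kind. *)
Definition observable (T : finType) (f : AZ A -> T) : Prop :=
  forall t, measurable [set x | f x = t].

Lemma observable_set (T : finType) (f : AZ A -> T) (Q : T -> Prop) :
  observable f -> measurable [set x | Q (f x)].
Proof.
move=> mf; rewrite [X in measurable X](_ : _ =
  \bigcup_(t in [set t | Q t]) [set x | f x = t]).
  by apply: fin_bigcup_measurable => // t _; apply: mf.
by apply/seteqP; split=> [x Qx|x [t /= Qt ->]] //; exists (f x).
Qed.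

Lemma observable_coord (i : int) : observable (fun x : AZ A => x i).
Proof. by move=> a; apply: sub_sigma_algebra; exists i, a. Qed.

Lemma observable_comp2 (T1 T2 T : finType) (g : T1 -> T2 -> T) f1 f2 :
  observable f1 -> observable f2 -> observable (fun x => g (f1 x) (f2 x)).
Proof.
move=> mf1 mf2 t.
rewrite [X in measurable X](_ : _ = \bigcup_(t1 in [set: T1])
    ([set x | f1 x = t1] `&` [set x | g t1 (f2 x) = t])).
  apply: fin_bigcup_measurable => // t1 _; apply: measurableI (mf1 t1) _.
  exact: (observable_set (fun t2 => g t1 t2 = t)).
apply/seteqP; split=> x /= => [gx|[t1 _ [<- //]]].
by exists (f1 x).
Qed.

Lemma observable_sum m l (phi : nat -> A -> {ffun 'I_m -> A}) (c : nat -> int) :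
  observable (fun x => \sum_(i < l) phi i (x (c i))).
Proof.
elim: l => [|l IHl].
  move=> t; under eq_set do rewrite big_ord0.
  have [<-|t0] := eqVneq 0 t.
    by rewrite (_ : mkset _ = setT) //; apply/seteqP; split.
  rewrite (_ : mkset _ = set0) //; apply/seteqP.
  by split=> // x /= /eqP; apply/negP.
under eq_fun do rewrite big_ord_recr /=.
apply: (observable_comp2 (fun u v : {ffun 'I_m -> A} => u + v) IHl).
move=> t; exact: (observable_set (fun a => phi l a = t) (observable_coord (c l))).
Qed.

Lemma observable_window_iter_Phi n m :
  observable (fun x => window m (iter n (@Phi A) x)).
Proof.
under eq_fun do rewrite (window_iter_Phi _ (leqnn _)) big_mkord.
exact: (observable_sum _ (window_coef n m) (fun t => t%:Z)).
Qed.

Variable lam : probability (AZ A) R.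

Definition prob (S : set (AZ A)) : R := fine (lam S).

Lemma probE S : measurable S -> lam S = (prob S)%:E.
Proof. by move=> mS; rewrite /prob fineK // fin_num_measure. Qed.

Lemma prob_partition (T : finType) (f : AZ A -> T) S :
  observable f -> measurable S ->
  prob S = \sum_t prob (S `&` [set x | f x = t]).
Proof.
move=> mf mS; apply: EFin_inj; rewrite -sumEFin -probE //.
have mSf t : measurable (S `&` [set x | f x = t]) by apply: measurableI.
rewrite {1}(_ : S = \bigcup_(t in [set: T]) (S `&` [set x | f x = t])); last first.
  by apply/seteqP; split=> [x Sx|x [t _ []]] //; exists (f x).
rewrite measure_fin_bigcup //; [|exact: finite_finset|]; last first.
  by move=> t1 t2 _ _ [x [[_ /= <-] [_ /= <-]]].
rewrite (_ : [set: T] = [set` index_enum T]); last first.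
  by apply/seteqP; split=> // t _ /=; rewrite mem_index_enum.
by rewrite -fsbig_seq ?index_enum_uniq //; apply: eq_bigr => t _; exact: probE.
Qed.

Lemma prob_concentrated (T : finType) (f : AZ A -> T) S (W : {set T}) :
  observable f -> measurable S -> lam S = 1%E ->
  (forall x, S x -> f x \in W) ->
  \sum_(t in W) prob [set x | f x = t] = 1.
Proof.
move=> mf mS S1 SW.
have mW : measurable [set x | f x \in W] by apply: (observable_set (fun t => t \in W)).
have W1 : prob [set x | f x \in W] = 1.
  apply: EFin_inj; rewrite -probE //; apply/eqP; rewrite eq_le probability_le1 //=.
  by rewrite -S1 le_measure // inE.
rewrite -W1 (prob_partition mf mW) [RHS](bigID (mem W)) /=.
rewrite [X in _ + X]big1 ?addr0 => [|t tW].
  apply: eq_bigr => t tW; congr prob; apply/seteqP; split=> x /=.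
    by move=> xt; rewrite xt.
  by case.
rewrite (_ : _ `&` _ = set0) /prob ?measure0 //.
by apply/seteqP; split=> // x [/= xW xt]; rewrite xt (negbTE tW) in xW.
Qed.

End FiniteObservables.

Section MarkovMeasure.
Variables (R : realType) (A : finZmodType) (M : rel A).
Variables (pi : A -> R) (P : A -> A -> R) (mu : probability (AZ A) R).
Hypothesis mu_markov : markov_measure pi P mu.

Definition weight (k : nat) (u : nat -> A) : R :=
  pi (u 0%N) * \prod_(i < k) P (u i) (u i.+1).

Definition cylinder (k : nat) (u : nat -> A) : set (AZ A) :=
  [set x | forall i : nat, (i <= k)%N -> x i%:Z = u i].

Lemma measurable_cylinder k u : measurable (cylinder k u).
Proof.
rewrite (_ : cylinder k u =
  \bigcap_(i in [set i : nat | (i <= k)%N]) [set x | x i%:Z = u i]) //.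
by apply: bigcap_measurableType => i _; apply: observable_coord.
Qed.

Lemma prob_cylinder k u : prob mu (cylinder k u) = weight k u.
Proof.
case: mu_markov => _ _ _ mu_cyl; rewrite /prob.
have := mu_cyl 0 k [tuple u i | i < k.+1].
rewrite (_ : [set x | block x 0 k.+1 = _] = cylinder k u) => [->|].
  rewrite /= /weight /thead tnth_mktuple; congr (_ * _).
  have uE i : (i < k.+1)%N -> nth 0 [tuple u i | i < k.+1] i = u i.
    by move=> lt_i; rewrite -[i]/(val (Ordinal lt_i)) -tnth_nth tnth_mktuple.
  by apply: eq_bigr => i _; rewrite !uE // ltnS // ltnW.
apply/seteqP; split=> x /= => [xu i|xu].
  rewrite -ltnS => lt_i; have := congr1 (fun t => tnth t (Ordinal lt_i)) xu.
  by rewrite !tnth_mktuple add0r.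
apply: eq_from_tnth => i; rewrite !tnth_mktuple add0r xu //.
by rewrite -ltnS.
Qed.

(** Condition on the letters one at a time, from left to right: each step adds
    one letter to the cylinder and removes one term from the sum. *)
Lemma prob_transfer m (phi : nat -> A -> {ffun 'I_m -> A}) g l k u w :
  prob mu (cylinder k u `&`
    [set x | w + \sum_(i < l) phi (k.+1 + i)%N (x (k.+1 + i)%N%:Z) = g]) =
  weight k u * transfer P phi k.+1 l (fun _ z => (z == g)%:R) (u k) w.
Proof.
elim: l k u w => [|l IHl] k u w.
  rewrite /= -prob_cylinder; have [->|ne_wg] := eqVneq w g.
    rewrite mulr1; congr prob; apply/seteqP; split=> x; first by case.
    by move=> ux; split=> //=; rewrite big_ord0 addr0.
  rewrite mulr0 (_ : _ `&` _ = set0) /prob ?measure0 //.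
  apply/seteqP; split=> // x [_] /=; rewrite big_ord0 addr0 => /eqP.
  by rewrite (negbTE ne_wg).
rewrite (prob_partition _ (observable_coord k.+1%:Z)); last first.
  apply: measurableI; first exact: measurable_cylinder.
  apply: (observable_set (fun z => w + z = g)).
  exact: (observable_sum l.+1 (fun i => phi (k.+1 + i)%N)
                         (fun i => (k.+1 + i)%N%:Z)).
rewrite /= mulr_sumr; apply: eq_bigr => b _.
pose u' i := if i == k.+1 then b else u i.
have u'E i : (i <= k)%N -> u' i = u i.
  by rewrite /u'; case: eqP => // ->; rewrite ltnn.
have u'b : u' k.+1 = b by rewrite /u' eqxx.
set v := (fun (_ : A) z => (z == g)%:R : R).
have -> : weight k u * (P (u k) b * transfer P phi k.+2 l v b (w + phi k.+1 b))
    = weight k.+1 u' *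
      transfer P phi k.+2 l v (u' k.+1) (w + phi k.+1 (u' k.+1)).
  rewrite mulrA u'b; congr (_ * _).
  rewrite /weight big_ord_recr /= mulrA u'b !u'E //; congr (_ * _ * _).
  by apply: eq_bigr => i _; rewrite !u'E // ltnW.
rewrite -IHl; congr prob; apply/seteqP; split=> x /=.
  move=> [[xu xg] xb]; split.
    move=> i; rewrite leq_eqVlt => /predU1P[->|]; first by rewrite u'b.
    by rewrite ltnS => le_ik; rewrite u'E // xu.
  move: xg; rewrite big_ord_recl addn0 xb addrA u'b => <-.
  by congr (_ + _); apply: eq_bigr => i _; rewrite addSnnS.
move=> [xu xg]; have xb : x k.+1%:Z = b by rewrite xu.
split=> //; split.
  by move=> i le_ik; rewrite xu ?u'E // ltnW.
rewrite big_ord_recl addn0 xb addrA -xg u'b.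
by congr (_ + _); symmetry; apply: eq_bigr => i _; rewrite addSnnS.
Qed.

Lemma prob_window n m K g : (n + m <= K.+1)%N ->
  prob mu [set x | window m (iter n (@Phi A) x) = g] =
  \sum_a pi a *
    transfer P (window_coef n m) 1 K (fun _ z => (z == g)%:R) a (window_coef n m 0 a).
Proof.
move=> le_K; rewrite (prob_partition _ (observable_coord 0)); last first.
  exact: observable_window_iter_Phi.
apply: eq_bigr => a _.
have <- : weight 0 (fun=> a) = pi a by rewrite /weight big_ord0 mulr1.
rewrite -prob_transfer; congr prob; apply/seteqP; split=> x /=.
  move=> [xg x0]; split=> [i|]; first by rewrite leqn0 => /eqP ->.
  rewrite -xg (window_iter_Phi _ le_K) big_mkord big_ord_recl x0.
  by congr (_ + _).
move=> [xa xg]; have x0 := xa 0%N isT; split=> //.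
by rewrite -xg (window_iter_Phi _ le_K) big_mkord big_ord_recl x0.
Qed.

Lemma measurable_markov_shift : measurable (markov_shift M).
Proof.
rewrite (_ : markov_shift M = \bigcap_(k : nat)
   ([set x | M (x k%:Z) (x (k%:Z + 1))] `&`
    [set x | M (x (- k.+1%:Z)) (x (- k.+1%:Z + 1))])); last first.
  apply/seteqP; split=> x Mx; first by move=> k _; split; apply: Mx.
  by case=> k; have [] := Mx k I; rewrite // -NegzE.
have mM i : measurable [set x : AZ A | M (x i) (x (i + 1))].
  apply: (observable_set (fun b => is_true b)
    (f := fun x : AZ A => M (x i) (x (i + 1)))).
  by apply: observable_comp2; apply: observable_coord.
apply: bigcap_measurableType => k _; apply: measurableI; exact: mM.
Qed.

Hypothesis P_M : compatible P M.

(** Off the Markov shift some pair of adjacent letters is forbidden.  For fixed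
    coordinates such a pair has probability 0 by compatibility, and there are
    countably many coordinates. *)
Lemma markov_shift_full : mu (markov_shift M) = 1%E.
Proof.
case: (mu_markov) => -[P_ge0 _] _ _ mu_cyl.
pose bad i : set (AZ A) := [set x | ~~ M (x i) (x (i + 1))].
have obs i : observable (fun x : AZ A => (x i, x (i + 1))).
  apply: (observable_comp2 (fun a b => (a, b))); exact: observable_coord.
have mbad i : measurable (bad i).
  exact: (observable_set (fun ab => ~~ M ab.1 ab.2) (obs i)).
have bad0 i : mu.-negligible (bad i).
  apply/negligibleP => //; apply: etrans (probE mu (mbad i)) _.
  rewrite (prob_partition _ (obs i)) // big1 // => -[a b] _; rewrite /prob.
  have [Mab|nMab] := boolP (M a b).
    rewrite (_ : _ `&` _ = set0) ?measure0 //.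
    apply/seteqP; split=> // x []; rewrite /bad /= => nMx [xa xb].
    by rewrite xa xb Mab in nMx.
  rewrite (_ : _ `&` _ = [set x | block x i 2 = [tuple a; b]]).
    rewrite mu_cyl big_ord1 /=.
    have -> : P a b = 0.
      apply/eqP; rewrite eq_le P_ge0 andbT leNgt.
      by apply/negP => /P_M/idP; apply/negP.
    by rewrite mulr0.
  apply/seteqP; split=> x /=.
    move=> [_ [xa xb]]; apply: eq_from_tnth => -[[|[|//]] lt_j];
      by rewrite tnth_mktuple (tnth_nth 0) //= addr0.
  move=> xab; have := congr1 (fun t => tnth t 0) xab.
  have := congr1 (fun t => tnth t 1) xab.
  rewrite !tnth_mktuple !(tnth_nth 0) /bad /= addr0 => -> ->.
  by split.
have mM := measurable_markov_shift.
have G0 : mu (~` markov_shift M) = 0%E.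
  apply: measure_negligible; first exact: measurableC.
  apply: negligibleS (negligibleU
    (negligible_bigcup (fun k : nat => bad0 k%:Z))
    (negligible_bigcup (fun k : nat => bad0 (Negz k)))) => x /= /existsNP[i nM].
  by case: i nM => k nM; [left|right]; exists k => //; apply/negP.
by rewrite -[markov_shift M]setCK probability_setC ?G0 ?sube0 //; apply: measurableC.
Qed.

End MarkovMeasure.

(** * Density of digits and Cesaro means *)

Section Digits.
Variables (b w : nat).
Hypothesis lt_wb : (w < b)%N.

Fixpoint avoids (t n : nat) : bool :=
  if t is t'.+1 then (n %% b != w)%N && avoids t' (n %/ b)%N else true.

(** [w] occurs among the digits of [n] in base [b], possibly as a leading zero;
    [n0] and [n1] are the parts of [n] below and above this occurrence. *)
Definition has_digit (n : nat) : Prop :=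
  exists k n0 n1, (n0 < b ^ k)%N /\ n = (n0 + b ^ k * (w + b * n1))%N.

Lemma has_digitP t n : ~~ avoids t n -> has_digit n.
Proof.
elim: t n => // t IHt n /=; rewrite negb_and negbK => /orP[/eqP Dw|].
  exists 0%N, 0%N, (n %/ b)%N; rewrite expn0; split=> //.
  by rewrite {1}(divn_eq n b) Dw; lia.
case/IHt=> k [n0 [n1 [lt_n0 Dn]]]; exists k.+1, (n %% b + b * n0)%N, n1.
have lt_mod : (n %% b < b)%N by rewrite ltn_mod; lia.
have le_b : (b * n0.+1 <= b * b ^ k)%N by rewrite leq_mul2l lt_n0 orbT.
rewrite expnS; split; first by rewrite mulnS in le_b; lia.
by rewrite {1}(divn_eq n b) Dn; ring.
Qed.

(** Up to a bounded error, a proportion [(b.-1 / b) ^ t] of the integers avoids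
    [w] in the [t] lowest digits: removing the lowest digit, which has [b.-1]
    allowed values, leaves an integer that avoids [w] in [t.-1] digits. *)
Lemma sum_avoids t : exists C, forall N,
  (b ^ t * \sum_(0 <= n < N) avoids t n <= b.-1 ^ t * N + C)%N.
Proof.
elim: t => [|t [C IHt]].
  exists 0%N => N; rewrite !expn0 !mul1n addn0 /=.
  by rewrite sum_nat_const_nat subn0 muln1.
exists (b.-1 ^ t.+1 * b + b * b.-1 * C)%N => N.
(* Rounding [N] up to the multiple [b * N'] of [b] makes all values of the
   lowest digit occur equally often. *)
set N' := (N %/ b).+1.
have le_sum : (\sum_(0 <= n < N) avoids t.+1 n <=
               b.-1 * \sum_(0 <= n < N') avoids t n)%N.
  have le_N : (N <= b * N')%N.
    rewrite {1}(divn_eq N b) mulnS mulnC addnC leq_add2r ltnW // ltn_mod; lia.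
  apply: (@leq_trans (\sum_(0 <= n < b * N') avoids t.+1 n)).
    by rewrite [leqRHS](@big_cat_nat _ _ _ N) //= leq_addr.
  elim: N' {le_N} => [|N' IHN]; first by rewrite muln0 !big_geq.
  rewrite mulnS addnC (@big_cat_nat _ _ _ (b * N')) ?leq_addr //=.
  rewrite [X in (_ <= _ * X)%N]big_nat_recr //= mulnDr leq_add //.
  rewrite -[index_iota _ _]/(index_iota (0 + b * N') _) big_addn addKn big_mkord.
  under eq_bigr => i _.
    rewrite mulnC addnC modnMDl divnMDl ?modn_small ?divn_small ?addn0 //; last lia.
    over.
  rewrite (bigD1 (Ordinal lt_wb)) //= eqxx /= add0n.
  apply: (@leq_trans (\sum_(i < b | i != Ordinal lt_wb) avoids t N')).
    by apply: leq_sum => i _; case: (_ != _).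
  rewrite sum_nat_const cardC1 card_ord //.
have /(leq_mul (leqnn (b ^ t.+1))) := le_sum; move/leq_trans; apply.
have := leq_mul (leqnn (b * b.-1)%N) (IHt N'); rewrite !expnS => H.
have leN : (b * N' <= N + b)%N.
  by rewrite /N' mulnS addnC leq_add2r mulnC leq_divM.
have := leq_mul (leqnn (b.-1 * b.-1 ^ t)%N) leN.
move: H; set S := (\sum_(_ <= _ < _) _)%N; set x := (b ^ t)%N; set y := (_ ^ t)%N.
set c := b.-1; move: (b) => B; nia.
Qed.

End Digits.

Section Cesaro.
Variable R : realType.

Lemma exists_exp_le (x e : R) : 0 <= x < 1 -> 0 < e -> exists t : nat, x ^+ t <= e.
Proof.
move=> /andP[x_ge0 x_lt1] e_gt0.
have : (fun n => x ^+ n) @ \oo --> (0 : R) by apply: cvg_expr; rewrite ger0_norm.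
move=> /cvgrPdist_le /(_ _ e_gt0) [t _ /(_ t (leqnn t))] /=.
by rewrite sub0r normrN ger0_norm ?exprn_ge0 // => le_e; exists t.
Qed.

(** Of the three summands [e], one bounds [f] where the digit occurs, one the
    density of the integers that avoid it among their [t] lowest digits, and one
    the rounding error in that density. *)
Lemma cesaro_small_off_digit b w (f : nat -> R) e :
  (w < b)%N -> 0 < e -> (forall n, `|f n| <= 1) ->
  (forall n, has_digit b w n -> `|f n| <= e) ->
  exists N0, forall N, (N0 <= N)%N ->
    `|\sum_(0 <= n < N) f n| <= 3 * e * N%:R.
Proof.
move=> lt_wb e_gt0 f_le1 f_le_e.
have b_gt0 : 0 < b%:R :> R by rewrite ltr0n; lia.
have [t le_t] : exists t, (b.-1%:R / b%:R : R) ^+ t <= e.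
  apply: exists_exp_le => //; rewrite divr_ge0 ?ler0n //=.
  by rewrite ltr_pdivrMr // mul1r ltr_nat prednK //; lia.
have [C sumC] := sum_avoids lt_wb t.
have le_f N : `|\sum_(0 <= n < N) f n| <=
              e * N%:R + (\sum_(0 <= n < N) avoids b w t n)%N%:R.
  apply: le_trans (ler_norm_sum _ _ _) _.
  have -> : e * N%:R = \sum_(0 <= n < N) e by rewrite sumr_const_nat subn0 mulr_natr.
  rewrite natr_sum -big_split; apply: ler_sum => n _ /=.
  have [_|/(has_digitP lt_wb) dig] := boolP (avoids b w t n).
    by rewrite (le_trans (f_le1 n)) // lerDr ltW.
  by rewrite addr0 f_le_e.
have avoids_le N : (\sum_(0 <= n < N) avoids b w t n)%N%:R <=
    e * N%:R + C%:R / b%:R ^+ t.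
  rewrite -(ler_pM2l (exprn_gt0 t b_gt0)) -natrX -natrM.
  apply: (@le_trans _ _ (b.-1 ^ t * N + C)%N%:R); first by rewrite ler_nat.
  rewrite natrD natrM !natrX mulrDr lerD //; last first.
    by rewrite mulrCA divff ?mulr1 // expf_neq0 // gt_eqF.
  rewrite mulrA ler_wpM2r // mulrC -ler_pdivrMr ?exprn_gt0 //.
  by rewrite -expr_div_n.
exists (Num.truncn (C%:R / e)).+1 => N le_N.
apply: le_trans (le_f N) _.
rewrite -[3]/(1 + 2%:R) mulrDl mul1r mulrDl lerD2l.
apply: le_trans (avoids_le N) _.
rewrite mulr2n mulrDl mul1r mulrDl lerD2l.
have le_C : C%:R / b%:R ^+ t <= C%:R :> R.
  rewrite ler_pdivrMr ?exprn_gt0 // ler_peMr ?ler0n // -natrX ler1n expn_gt0; lia.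
apply: le_trans le_C _; rewrite -ler_pdivrMl // mulrC.
apply: ltW; apply: lt_le_trans (truncnS_gt _) _; rewrite ?ler_nat //.
Qed.

Lemma cesaro_cvg (u : nat -> R) (l : R) :
  (forall e, 0 < e -> exists N0, forall N, (N0 <= N)%N ->
     `|\sum_(0 <= n < N) (u n - l)| <= e * N%:R) ->
  (fun N => N%:R^-1 * \sum_(0 <= n < N) u n) @ \oo --> l.
Proof.
move=> small; apply/cvgrPdist_le => e e_gt0; have [N0 le_N0] := small e e_gt0.
exists N0.+1 => // N /= lt_N.
have N_gt0 : 0 < N%:R :> R by rewrite ltr0n; lia.
have -> : l - N%:R^-1 * \sum_(0 <= n < N) u n =
          - (N%:R^-1 * \sum_(0 <= n < N) (u n - l)).
  rewrite sumrB sumr_const_nat subn0 mulrBr -[l *+ N]mulr_natl mulKf ?gt_eqF //.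
  by rewrite opprB.
rewrite normrN normrM ger0_norm ?invr_ge0 ?ler0n // mulrC ler_pdivrMr //.
by apply: le_N0; lia.
Qed.

(** If [a] varies by at most [e] on [W], it is within [e] of its mean over [W];
    this mean is [1 / #|W|], the constant value of [b]. *)
Lemma near_average (T : finType) (W : {set T}) (a b : T -> R) e :
  \sum_(t in W) a t = 1 -> \sum_(t in W) b t = 1 ->
  {in W &, forall t t', a t - a t' <= e} -> {in W &, forall t t', b t = b t'} ->
  {in W, forall t, `|a t - b t| <= e}.
Proof.
move=> a1 b1 a_e b_c t Wt.
have W_gt0 : 0 < #|W|%:R :> R by rewrite ltr0n; apply/card_gt0P; exists t.
have bt : #|W|%:R * b t = 1.
  rewrite -[RHS]b1 mulr_natl -sumr_const; apply: eq_bigr => t' Wt'; exact: b_c.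
have Wa (c : R) : #|W|%:R * c = \sum_(t' in W) c :> R by rewrite mulr_natl sumr_const.
have W_diff : #|W|%:R * (a t - b t) = \sum_(t' in W) (a t - a t').
  by rewrite sumrB -Wa a1 mulrBr bt.
rewrite ler_norml; apply/andP; split; rewrite -(ler_pM2l W_gt0) W_diff Wa.
  by apply: ler_sum => t' Wt'; rewrite lerNl opprB a_e.
by apply: ler_sum => t' Wt'; apply: a_e.
Qed.

End Cesaro.

(** * Mixing at times with a prescribed base-b digit *)

Lemma compatible_succ (R : realType) (A : finZmodType) (M : rel A)
    (P : A -> A -> R) :
  stochastic P -> compatible P M -> forall a, exists b, M a b.
Proof.
move=> [P_ge0 P_sum1] P_M a; apply/existsP; apply: contraT => /existsPn noM.
have := P_sum1 a; rewrite big1 => [/eqP|b _]; first by rewrite eq_sym oner_eq0.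
apply/eqP; rewrite eq_le P_ge0 andbT leNgt; apply/negP => /P_M.
exact/negP.
Qed.

(** The product of the positive transition probabilities is a lower bound, since
    all factors are at most 1. *)
Lemma compatible_lower_bound (R : realType) (A : finZmodType) (M : rel A)
    (P : A -> A -> R) :
  stochastic P -> compatible P M ->
  exists eps : R, 0 < eps <= 1 /\ forall a b, M a b -> eps <= P a b.
Proof.
move=> [P_ge0 P_sum1] P_M.
have P_le1 a b : P a b <= 1.
  by rewrite -(P_sum1 a) (bigD1 b) //= lerDl sumr_ge0.
pose q (ab : A * A) := P ab.1 ab.2.
have q_gt0 (ab : A * A) : M ab.1 ab.2 -> 0 < q ab by move/P_M.
exists (\prod_(ab | M ab.1 ab.2) q ab); split=> [|a b Mab].
  rewrite prodr_gt0 //=; apply: prodr_ile1 => ab _.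
  by rewrite P_ge0 P_le1.
rewrite (bigD1 (a, b)) //= ler_piMr ?P_ge0 //; apply: prodr_ile1 => ab _.
by rewrite P_ge0 P_le1.
Qed.

Section Mixing.
Variables (R : realType) (A : finZmodType) (M : rel A).
Variables (pi : A -> R) (P : A -> A -> R) (mu : probability (AZ A) R).
Hypothesis mu_markov : markov_measure pi P mu.
Hypothesis P_M : compatible P M.
Hypothesis M_irr : irreducible_incidence M.
Hypothesis M_grp : markov_subgroup M.
Variables (p s : nat).
Hypothesis p_pr : prime p.
Hypothesis A_tors : forall a : A, a *+ (p ^ s.+1)%N = 0.

(** The digit [w] consists, in base [p], of [c + s] zeros below [D] digits equal
    to [p.-1].  If it occurs in [n] with lower part [n0], then
    [n = n0 + p ^ j * p ^ s * q], where the [c] lowest of these zeros make [p ^ j]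
    at least [n0 + c], and the digits [p.-1] make [p ^ D] divide [q.+1].  So
    there are [D] loops, at distance [T = p ^ s * p ^ j] of each other. *)
Lemma prob_window_close m (e : R) : 0 < e ->
  exists b w, (w < b)%N /\ forall n, has_digit b w n ->
    forall x y, markov_shift M x -> markov_shift M y ->
      prob mu [set z | window m (iter n (@Phi A) z) = window m y] -
      prob mu [set z | window m (iter n (@Phi A) z) = window m x] <= e.
Proof.
move=> e_gt0; case: (mu_markov) => P_sto [pi_ge0 pi_sum1] _ _.
have [P_ge0 P_sum1] := P_sto.
have M_succ := compatible_succ P_sto P_M.
have [r r_gt0 M_walk] := irreducible_walk M_succ M_irr M_grp.
have [eps [/andP[eps_gt0 eps_le1] P_ge_eps]] := compatible_lower_bound P_sto P_M.
have [D le_e] : exists D, (1 - eps ^+ (m + r + r)) ^+ D <= e.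
  apply: exists_exp_le => //; rewrite subr_ge0 exprn_ile1 ?(ltW eps_gt0) //=.
  by rewrite gtrBl exprn_gt0.
set c := (m + r + r)%N in le_e.
have p_gt1 := prime_gt1 p_pr.
pose w := (p ^ (c + s) * (p ^ D).-1)%N; pose b := (p ^ (c + s + D))%N.
have pD_gt0 : (0 < p ^ D)%N by rewrite expn_gt0; lia.
have lt_wb : (w < b)%N.
  by rewrite /w /b [(p ^ (c + s + D))%N]expnD ltn_pmul2l ?expn_gt0; lia.
exists b, w; split=> // n [k [n0 [n1 [lt_n0 Dn]]]] x y Mx My.
pose j := ((c + s + D) * k + c)%N.
pose q := ((p ^ D).-1 + p ^ D * n1)%N.
have qS : q.+1 = (p ^ D * n1.+1)%N by rewrite mulnS -addSn prednK.
have {}Dn : n = (n0 + p ^ j * (p ^ s * q))%N.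
  rewrite Dn /w /b -!expnM /j /q !expnD; ring.
have le_j : (n0 + c <= p ^ j)%N.
  have := ltn_expl c p_gt1; rewrite /j expnD expnM => lt_c.
  apply: leq_trans (leq_mul lt_n0 lt_c); rewrite mulSn mulnS; lia.
set T := (p ^ s * p ^ j)%N.
have le_jT : (p ^ j <= T)%N by rewrite /T leq_pmull // expn_gt0; lia.
have loops i : (i < D)%N ->
    has_loop (window_coef n m) M (1 + (n0 + T - r) + i * T) c (window m (x - y)).
  move=> lt_iD; rewrite Dn.
  have lt_D := ltn_expl D p_gt1.
  (* The translate by 0 is skipped: its support could start left of the
     coordinates that the chain visits. *)
  have := @has_loop_iter_Phi _ _ M_succ M_irr M_grp _ r_gt0 M_walk _ _ p_pr A_tors
    n0 j D q i.+1 m (x - y).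
  rewrite -/T -/c (_ : (1 + (n0 + T - r) + i * T = (n0 + i.+1 * T - r).+1)%N).
    apply=> //.
    - by rewrite qS dvdn_mulr.
    - by lia.
    - by rewrite /q; lia.
    - by rewrite /c in le_j; lia.
    - exact: markov_shiftB.
  by rewrite mulSn; rewrite /c in le_j; lia.
set h := window m (x - y) in loops.
pose K := (n0 + T - r + D * T + (n + m))%N.
have le_K : (n + m <= K.+1)%N by rewrite /K; lia.
rewrite !(prob_window mu_markov _ le_K) -sumrB.
set v := fun (_ : A) z => (z == window m x)%:R : R.
(* The two indicator functions are translates of each other by [h], so the
   difference of the probabilities is the expectation of an increment. *)
have -> : (fun (_ : A) z => (z == window m y)%:R : R) = fun a z => v a (z + h).
  apply/funext => a; apply/funext => z; rewrite /v; congr (nat_of_bool _)%:R.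
  rewrite eq_sym [RHS]eq_sym -subr_eq /h; congr (_ == _).
  by apply/ffunP => i; rewrite !ffunE opprB addrC subrK.
apply: le_trans le_e; set bound := _ ^+ D.
have -> : bound = \sum_a pi a * bound by rewrite -mulr_suml pi_sum1 mul1r.
apply: ler_sum => a _; rewrite -mulrBr ler_wpM2l // transfer_shift.
rewrite -[bound]mulr1.
apply: (@transfer_mixing _ _ _ P _ P_ge0 P_sum1 M eps _ P_ge_eps _ M_succ _ _
          (n0 + T - r) c h (p ^ s.+1) T).
- exact: ltW.
- exact: incidenceD.
- exact: window_coefD.
- by rewrite expn_gt0; lia.
- by apply/ffunP => i; rewrite ffunMnE A_tors ffunE.
- by rewrite /c in le_j *; lia.
- by rewrite /K; lia.
- by [].
- by move=> b' u; rewrite /increment /v; do 2!case: (_ == _) => /=; lra.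
Qed.

End Mixing.

(** * Convergence to the Haar measure *)

Definition markov_windows (A : finZmodType) (M : rel A) (m : nat) :
    {set {ffun 'I_m -> A}} :=
  [set g | `[< exists2 x, markov_shift M x & window m x = g >]].

Lemma markov_windowsP (A : finZmodType) (M : rel A) m g :
  reflect (exists2 x, markov_shift M x & window m x = g)
          (g \in markov_windows M m).
Proof. by rewrite inE; apply: asboolP. Qed.

Lemma block_window (A : finZmodType) m (g : m.-tuple A) (x : AZ A) :
  block x 0 m = g <-> window m x = [ffun i => tnth g i].
Proof.
split=> [<-|/ffunP xg].
  by apply/ffunP => i; rewrite !ffunE tnth_mktuple add0r.
by apply: eq_from_tnth => i; have := xg i; rewrite !ffunE tnth_mktuple add0r.
Qed.

Lemma admissible_markov_window (A : finZmodType) (M : rel A) m (g : m.-tuple A) :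
  (forall a, exists b, M a b) -> irreducible_incidence M ->
  g \in admissible_words M m -> [ffun i => tnth g i] \in markov_windows M m.
Proof.
move=> M_succ M_irr; rewrite inE => /forallP adm; apply/markov_windowsP.
have M_nth i : (i < m.-1)%N -> M (nth 0 g i) (nth 0 g i.+1).
  move=> lt_i; have lt_i1 : (i < m)%N by lia.
  have lt_i2 : (i.+1 < m)%N by lia.
  have /forallP/(_ (Ordinal lt_i2)) := adm (Ordinal lt_i1).
  by rewrite eqxx inE !(tnth_nth 0).
have [x Mx xg] := markov_shift_extend M_succ M_irr M_nth.
exists x => //; apply/ffunP => i; rewrite !ffunE xg ?(tnth_nth 0) //.
by have := ltn_ord i; lia.
Qed.

Lemma markov_shift_iter_Phi (A : finZmodType) (M : rel A) n x :
  markov_subgroup M -> markov_shift M x -> markov_shift M (iter n (@Phi A) x).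
Proof.
move=> M_grp Mx; elim: n => //= n IHn; rewrite /Phi.
by apply: markov_shiftD => // i; apply: IHn.
Qed.

(** Translation by the configuration [y - x] of the subgroup maps the event that
    the window is that of [x] onto the event that it is that of [y]. *)
Lemma haar_window_uniform (R : realType) (A : finZmodType) (M : rel A)
    (nu : probability (AZ A) R) m :
  markov_subgroup M -> haar_measure (markov_shift M) nu ->
  {in markov_windows M m &, forall g g',
    prob nu [set x | window m x = g] = prob nu [set x | window m x = g']}.
Proof.
move=> M_grp [_ nu_inv] _ _ /markov_windowsP[x Mx <-] /markov_windowsP[y My <-].
have mW : measurable [set z : AZ A | window m z = window m x].
  exact: (@observable_window_iter_Phi _ 0 m).
rewrite /prob -(nu_inv _ _ (markov_shiftB M_grp My Mx) mW).
have windowD u v : window m (u + v : AZ A) = window m u + window m v.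
  by apply/ffunP => i; rewrite !ffunE.
congr (fine (nu _)); apply/seteqP; split=> z /=.
  by case=> z' /= z'x <-; rewrite windowD z'x -windowD subrK.
move=> zy; exists (x - y + z); last by rewrite addrA -[x - y]opprB subrr add0r.
by rewrite /= windowD zy -windowD subrK.
Qed.

Theorem theorem1p1 (R : realType) (A : finZmodType) (M : rel A)
    (pi : A -> R) (P : A -> A -> R) (mu nu : probability (AZ A) R)
    (p s : nat)
    (hG : markov_subgroup M)
    (hmu : markov_measure pi P mu)
    (hPM : compatible P M)
    (hp : prime p) (hs : (1 <= s)%N)
    (hA : forall g : A, g *+ (p ^ s)%N = 0)
    (hM : irreducible_incidence M)
    (hnu : haar_measure (markov_shift M) nu)
    (m : nat) (hm : (1 <= m)%N)
    (g : m.-tuple A) (hg : g \in admissible_words M m) :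
  ((N%:R^-1)%:E *
    \sum_(0 <= n < N)
      mu [set x : AZ A | block (iter n (@Phi A) x) 0 m = g])%E
    @[N --> \oo]
  --> nu [set x : AZ A | block x 0 m = g].
Proof.
case: s hs hA => // s _ hA; pose gw := [ffun i => tnth g i].
have [P_sto _ _ _] := hmu.
have Wg : gw \in markov_windows M m.
  exact: admissible_markov_window (compatible_succ P_sto hPM) hM hg.
pose a n h := prob mu [set x | window m (iter n (@Phi A) x) = h].
pose b h := prob nu [set x : AZ A | window m x = h].
have mw n h := @observable_window_iter_Phi A n m h.
have -> : nu [set x : AZ A | block x 0 m = g] = (b gw)%:E.
  rewrite -(probE nu (mw 0%N gw)); congr (nu _).
  by apply/seteqP; split=> x /block_window.
have muE n : mu [set x | block (iter n (@Phi A) x) 0 m = g] = (a n gw)%:E.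
  rewrite -(probE mu (mw n gw)); congr (mu _).
  by apply/seteqP; split=> x /block_window.
have -> : (fun N => (N%:R^-1)%:E * \sum_(0 <= n < N)
      mu [set x : AZ A | block (iter n (@Phi A) x) 0 m = g])%E =
    EFin \o (fun N => N%:R^-1 * \sum_(0 <= n < N) a n gw).
  apply/funext => N /=; rewrite EFinM -sumEFin; congr (_ * _)%E.
  by apply: eq_bigr => n _; rewrite muE.
apply: cvg_EFin; first exact: nearW.
apply: cesaro_cvg => e e_gt0.
have e3_gt0 : 0 < e / 3 by rewrite divr_gt0.
have [d [w [lt_wd close]]] := prob_window_close hmu hPM hM hG hp hA m e3_gt0.
have prob01 (lam : probability (AZ A) R) S : measurable S -> 0 <= prob lam S <= 1.
  move=> mS; rewrite /prob fine_ge0 //= -lee_fin fineK ?fin_num_measure //.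
  exact: probability_le1.
have [] := @cesaro_small_off_digit R d w (fun n => a n gw - b gw) (e / 3) lt_wd.
- by [].
- move=> n; have := prob01 mu _ (mw n gw); have := prob01 nu _ (mw 0%N gw).
  rewrite -/(a n gw) -/(b gw) => /andP[? ?] /andP[? ?].
  by rewrite ler_norml; lra.
- move=> n dig.
  apply: (near_average (W := markov_windows M m) (a := a n) (b := b)) Wg.
  + apply: prob_concentrated (mw n) (measurable_markov_shift M) _ _.
      exact: markov_shift_full hmu hPM.
    move=> x Mx; apply/markov_windowsP; exists (iter n (@Phi A) x) => //.
    exact: markov_shift_iter_Phi.
  + apply: prob_concentrated (mw 0%N) (measurable_markov_shift M) hnu.1 _.
    by move=> x Mx; apply/markov_windowsP; exists x.
  + move=> _ _ /markov_windowsP[y My <-] /markov_windowsP[x Mx <-].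
    exact: close.
  + exact: haar_window_uniform.
move=> N0 le_N0; exists N0 => N /le_N0.
by rewrite [3 * _]mulrC divfK.
Qed.
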